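(* Let $A$ be an infinite set of positive integers such that $1\in A$ and $|A\cap\{1,2,\ldots,n\}|=(1+o(1))\frac{\log n}{\log\log n}$, where the $o(1)$ term tends to $0$ as $n\to\infty$. Then there exist an integer $n_0$ and an infinite set $M$ of positive integers such that $0<p(n,A,M)<n^{8+o(1)}$ for all $n>n_0$, where the $o(1)$ term tends to $0$ as $n\to\infty$.
   Context: For sets $A$, $M$ of positive integers and a positive integer $n$, $p(n,A,M)$ denotes the number of representations of $n$ in the form $n=\sum_{a\in A} m_a a$, where $m_a\in M\cup\{0\}$ for every $a\in A$ and all but finitely many $m_a$ equal $0$. Logarithms are base $2$. *)

(* Defs.v *)
From HB Require Import structures.
From mathcomp Require Import all_boot all_order all_algebra.
From mathcomp Require Import finmap.
From mathcomp Require Import all_classical all_reals all_analysis.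

Set Implicit Arguments.
Unset Strict Implicit.
Unset Printing Implicit Defensive.

Import Order.TTheory GRing.Theory Num.Theory.
Import numFieldNormedType.Exports.

Local Open Scope classical_set_scope.
Local Open Scope ring_scope.

(* The family (m_a) for a in A is encoded as a finitely supported function on
   nat that vanishes outside A. *)
Definition representations (n : nat) (A M : set nat) :
    set {fsfun nat -> nat with 0%N} :=
  [set m : {fsfun nat -> nat with 0%N} |
    [/\ forall a, A a -> (M `|` [set 0%N]) (m a),
        forall a, ~ A a -> m a = 0%N
      & (n = \sum_(a <- finsupp m) m a * a)%N]].

(* [fset_set] is junk (empty) on infinite sets; [finite_representations] shows
   that this case does not occur when A consists of positive integers. *)
Definition p (n : nat) (A M : set nat) : nat :=
  #|` fset_set (representations n A M)|%fset.

Lemma finite_representations (n : nat) (A M : set nat) :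
  (forall a, A a -> (0 < a)%N) -> finite_set (representations n A M).
Proof.
move=> A0.
have bd (m : {fsfun nat -> nat with 0%N}) a : representations n A M m -> (m a * a <= n)%N.
  move=> [_ _ ->]; have [am|am] := boolP (a \in finsupp m).
    by rewrite (big_fsetD1 a)//= leq_addr.
  by rewrite fsfun_dflt.
pose f (m : {fsfun nat -> nat with 0%N}) : {ffun 'I_n.+1 -> 'I_n.+1} :=
  [ffun i : 'I_n.+1 => inord (m i)].
have mpos (m : {fsfun nat -> nat with 0%N}) a : representations n A M m -> m a != 0%N -> (0 < a)%N.
  by move=> [_ mA _] ma0; apply: A0; apply: contrapT => /mA /eqP; apply/negP.
have val_le (m : {fsfun nat -> nat with 0%N}) a : representations n A M m -> (m a <= n)%N.
  move=> rm; have [->//|ma0] := eqVneq (m a) 0%N.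
  by rewrite (leq_trans _ (bd m a rm))// leq_pmulr// (mpos m).
have arg_le (m : {fsfun nat -> nat with 0%N}) a : representations n A M m -> m a != 0%N -> (a <= n)%N.
  by move=> rm ma0; rewrite (leq_trans _ (bd m a rm))// leq_pmull// lt0n.
have finj : {in representations n A M &, injective f}.
  move=> m m' /set_mem rm /set_mem rm' /ffunP ff; apply/fsfunP => a.
  have [an|an] := leqP a n.
    have := ff (Ordinal (an : (a < n.+1)%N)).
    by rewrite !ffunE => /(congr1 val); rewrite /= !inordK// ltnS val_le.
  have z (k : {fsfun nat -> nat with 0%N}) : representations n A M k -> k a = 0%N.
    move=> rk; apply: contraTeq an => /(arg_le k a rk).
    by rewrite -leqNgt.
  by rewrite !z.
by rewrite -(eq_finite_set (inj_card_eq finj)); exact: finite_finset.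
Qed.

Definition count_upto (A : set nat) (n : nat) : nat :=
  #|` fset_set (A `&` [set a | (1 <= a <= n)%N])|%fset.

Definition log2 {R : realType} (x : R) : R := ln x / ln 2.

(* Main.v *)
(* M consists of the numbers 2^(t/3) + x 2^i with x < 2 t^5 and i <= t.  Only
   O((log n)^7) of them are at most n, because the offset forces t = O(log n);
   hence p(n, A, M) <= (log n)^(8 |A(n)|), which is n^(8 + o(1)).

   For 2^t <= n < 2^(t+1), give every a in A with a <= 2^(t/3) the coefficient
   2^(t/3); this uses up at most n.  Write what is left as a sum of x_a 2^(i_a) a,
   running through these a in decreasing order and taking for x_a 2^(i_a) a
   truncation of the quotient to about log(t^5) leading bits.  Each step brings
   the remainder r below a or divides it by t^5.  The density of A gives
   a <= (t^5)^(number of smaller elements of A) and n < (t^5)^|A(2^(t/3))|, so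
   r < (t^5)^(number of elements still to be used) throughout, and r = 0 at
   the end. *)
Require Import Defs.
From mathcomp Require Import all_boot all_order all_algebra finmap.
From mathcomp Require Import all_classical all_reals all_analysis.
From mathcomp Require Import zify ring lra.
Import Order.TTheory GRing.Theory Num.Theory.
Import numFieldNormedType.Exports.
Local Open Scope classical_set_scope.
Local Open Scope ring_scope.

Set Implicit Arguments.
Unset Strict Implicit.

(** * The counting function of [A] *)

Lemma count_uptoE (A : set nat) (n : nat) :
  count_upto A n = count (fun a => `[< A a >]) (index_iota 1 n.+1).
Proof.
rewrite /count_upto -size_filter.
set s := [seq _ <- _ | _].
have -> : A `&` [set a | (1 <= a <= n)%N] = [set` s].
  apply/seteqP; split => a /=; rewrite mem_filter mem_index_iota ltnS.
    by move=> [Aa ->]; rewrite andbT; apply/asboolP.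
  by move=> /andP[/asboolP].
have us : uniq s by rewrite filter_uniq// iota_uniq.
have -> : fset_set [set` s] = [fset x in s]%fset.
  by apply/fsetP => x; rewrite in_fset_set ?mem_setE ?inE //; apply: finite_seq.
by rewrite card_fseq undup_id.
Qed.

Lemma count_upto0 (A : set nat) : count_upto A 0 = 0%N.
Proof. by rewrite count_uptoE. Qed.

Lemma count_uptoS (A : set nat) (n : nat) :
  count_upto A n.+1 = (count_upto A n + `[< A n.+1 >])%N.
Proof.
rewrite !count_uptoE /index_iota !subSS !subn0.
have -> : iota 1 n.+1 = iota 1 n ++ [:: n.+1] by rewrite -(addn1 n) iotaD add1n addn1.
by rewrite count_cat/= addn0.
Qed.

Lemma leq_count_upto (A : set nat) : {homo count_upto A : m n / (m <= n)%N}.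
Proof. by apply: homo_leq => // [? ? ?|n]; [exact: leq_trans|rewrite count_uptoS leq_addr]. Qed.

(** * Greedy expansion with rounded quotients *)

Lemma float_approx (X q t : nat) : (1 < X)%N -> (q < 2 ^ t.+1)%N ->
  exists x i, [/\ (x < X)%N, (i <= t)%N, (x * 2 ^ i <= q)%N
    & (q < x * 2 ^ i + 2 ^ i)%N /\ ((0 < i)%N -> (X * 2 ^ i <= 2 * q)%N)].
Proof.
move=> X1 qt.
have ex : exists i, (q %/ 2 ^ i < X)%N.
  exists t; apply: leq_ltn_trans X1.
  by rewrite -ltnS ltn_divLR ?expn_gt0// -expnS.
(* The least shift bringing the quotient below [X]: if [i > 0], the shift [i - 1] still leaves at
   least [X], whence [X * 2 ^ i <= 2 * q]. *)
case: (ex_minnP ex) => i iX imin; exists (q %/ 2 ^ i)%N, i; split => //.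
- apply: imin; apply: leq_ltn_trans X1.
  by rewrite -ltnS ltn_divLR ?expn_gt0// -expnS.
- exact: leq_divM.
- split; first by rewrite -mulSnr ltn_ceil ?expn_gt0.
  case: i imin {iX} => // i imin _.
  have : (X <= q %/ 2 ^ i)%N by rewrite leqNgt; apply/negP => /imin; rewrite ltnn.
  by rewrite leq_divRL ?expn_gt0// expnS mulnCA leq_pmul2l.
Qed.

(* [r %/ a] rounded down to a float loses a factor [Y]; the first alternative is
   the case where [r %/ a] is itself a float. *)
Lemma greedy_step (Y r a t : nat) : (0 < Y)%N -> (0 < a)%N -> (r < 2 ^ t.+1)%N ->
  exists x i, [/\ (x < 2 * Y)%N, (i <= t)%N, (x * 2 ^ i * a <= r)%N
    & (r - x * 2 ^ i * a < a)%N \/ (Y * (r - x * 2 ^ i * a) <= r)%N].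
Proof.
move=> Y0 a0 rt.
have [||x [i [xX it xq [qx hi]]]] := @float_approx (2 * Y)%N (r %/ a)%N t.
- lia.
- exact: leq_ltn_trans (leq_div _ _) rt.
exists x, i; split => //; first by rewrite -leq_divRL.
have rlt : (r < (x * 2 ^ i + 2 ^ i) * a)%N by rewrite -ltn_divLR.
case: i it xq qx hi rlt => [|i] it xq qx hi rlt; [left|right].
  by move: rlt; rewrite expn0 muln1; nia.
have {}hi := hi isT.
(* The loss is at most [2 ^ i.+1 * a], and [hi] gives [Y * 2 ^ i.+1 * a <= (r %/ a) * a <= r]. *)
have : (r - x * 2 ^ i.+1 * a <= 2 ^ i.+1 * a)%N by rewrite leq_subLR -mulnDl ltnW.
move/(leq_mul (leqnn Y))/leq_trans; apply.
have := leq_mul hi (leqnn a); have := leq_divM r a.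
set z := (r %/ a)%N; set w := (2 ^ _)%N; nia.
Qed.

(* The remainder stays below [Y ^ (number of elements of A still to be used)]. *)
Lemma greedy (A : set nat) (Y t N r : nat) : (0 < Y)%N ->
  (forall a, (a < N)%N -> A a.+1 -> (a.+1 <= Y ^ count_upto A a)%N) ->
  (r < Y ^ count_upto A N)%N -> (r < 2 ^ t.+1)%N ->
  exists2 f : nat -> nat,
    forall a, exists x i, [/\ (x < 2 * Y)%N, (i <= t)%N & f a = (x * 2 ^ i)%N]
  & r = (\sum_(1 <= a < N.+1 | `[< A a >]) f a * a)%N.
Proof.
move=> Y0; elim: N r => [|N IH] r hA.
  rewrite count_upto0 expn0 ltnS leqn0 => /eqP -> _.
  exists (fun=> 0%N); last by rewrite big_nil.
  by exists 0%N, 0%N; split; rewrite ?muln_gt0 ?Y0.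
have hA' a : (a < N)%N -> A a.+1 -> (a.+1 <= Y ^ count_upto A a)%N.
  by move=> aN; apply: hA; rewrite ltnS ltnW.
rewrite count_uptoS; case: asboolP => [AN|nAN]; last first.
  rewrite addn0 => /IH{}IH /IH[]// f fP ->; exists f => //.
  by rewrite [RHS]big_mkcond/= big_nat_recr//= -big_mkcond/=; case: asboolP => // _; rewrite addn0.
rewrite addn1 expnS => rY rt.
have [//|x [i [xY it xr near]]] := @greedy_step Y r N.+1 t Y0 _ rt.
have r'Y : (r - x * 2 ^ i * N.+1 < Y ^ count_upto A N)%N.
  (* A remainder below [N.+1] is covered by the size bound on [N.+1] itself; otherwise a factor [Y]
     cancels. *)
  case: near => [/leq_trans|le]; first by apply; apply: hA.
  by rewrite -(ltn_pmul2l Y0); apply: leq_ltn_trans rY.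
have [f fP rE] := IH _ hA' r'Y (leq_ltn_trans (leq_subr _ _) rt).
exists (fun a => if a == N.+1 then (x * 2 ^ i)%N else f a) => [a|].
  by case: eqP => _; [exists x, i|exact: fP].
rewrite big_mkcond/= big_nat_recr//= eqxx; case: asboolP => // _.
rewrite -[LHS](subnK xr) rE; congr addn.
rewrite big_mkcond/=; apply: eq_big_nat => a /andP[_ aN].
by rewrite (ltn_eqF aN).
Qed.

(** * The coefficient set *)

(* The offset [2 ^ (t %/ 3)] keeps the elements built for [n ~ 2 ^ t] large, so
   that only those with [t = O(log n)] lie below [n]. *)
Definition floats : set nat :=
  [set m | exists t x i, [/\ (x < 2 * t ^ 5)%N, (i <= t)%N
                           & m = (2 ^ (t %/ 3) + x * 2 ^ i)%N]].

Lemma floats_gt0 m : floats m -> (0 < m)%N.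
Proof. by move=> [t [x [i [_ _ ->]]]]; rewrite addn_gt0 expn_gt0. Qed.

Lemma infinite_floats : infinite_set floats.
Proof.
apply/infiniteP.
have inF : {homo (fun k => 2 ^ k.+1)%N : k / setT k >-> floats k}.
  (* Powers of 2 arise from [x = 0]; the exponent starts at 1 because no [x] is below
     [2 * 0 ^ 5]. *)
  move=> k _; exists (k.+1 * 3)%N, 0%N, 0%N; split => //.
  by rewrite mulnK// mul0n addn0.
have injF : {in setT &, injective (fun k => 2 ^ k.+1)%N}.
  by move=> a b _ _ /eqP; rewrite eqn_exp2l// => /eqP[].
rewrite -(card_le_eql (inj_card_eq injF)).
by apply: subset_card_le => _ [k _ <-]; apply: inF.
Qed.

(** With [L = trunc_log 2 n], an element at most [n] has [t %/ 3 <= L], so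
    [t < T = 3 * L + 3 <= 4 * L]. This leaves at most [2 * T ^ 7 <= 2 * 4 ^ 7 * L ^ 7] triples
    [(t, x, i)]; one more factor [L] absorbs the constant and the extra element 0. *)
Lemma floats_leq : exists L0, forall n, (L0 <= trunc_log 2 n)%N ->
  exists s : seq nat, (size s <= trunc_log 2 n ^ 8)%N /\
    forall m, (floats `|` [set 0%N]) m -> (m <= n)%N -> m \in s.
Proof.
exists (2 * 4 ^ 7 + 1)%N => n; set L := trunc_log 2 n => hL; set T := (3 * L + 3)%N.
have L3 : (3 <= L)%N by apply: leq_trans hL.
have n0 : (0 < n)%N by case: n @L {T} hL L3.
have TL : (T <= 4 * L)%N by rewrite /T; lia.
exists (0 :: [seq 2 ^ (t %/ 3) + z.1 * 2 ^ z.2 | t <- iota 0 T,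
   z <- [seq (x, i) | x <- iota 0 (2 * T ^ 5), i <- iota 0 T]])%N; split.
  rewrite /= !size_allpairs !size_iota.
  have -> : (T * (2 * T ^ 5 * T) = 2 * T ^ 7)%N by ring.
  have L7 : (0 < L ^ 7)%N by rewrite expn_gt0 (leq_trans _ L3).
  have : (T ^ 7 <= 4 ^ 7 * L ^ 7)%N by rewrite -expnMn leq_exp2r.
  rewrite [(L ^ 8)%N]expnS; have := leq_mul hL (leqnn (L ^ 7)%N).
  move: (4 ^ 7)%N (L ^ 7)%N (T ^ 7)%N L7 => c l w; nia.
move=> m [|-> _]; last by rewrite inE eqxx.
move=> [t [x [i [xt it ->]]]] mn; rewrite inE; apply/orP; right.
have tT : (t < T)%N.
  have : (2 ^ (t %/ 3) <= n)%N by apply: leq_trans mn; rewrite leq_addr.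
  move/(leq_trunc_log 2); rewrite trunc_expnK// -/L /T; lia.
apply/allpairsPdep; exists t, (x, i); split => //; first by rewrite mem_iota.
apply/allpairsPdep; exists x, i; split => //; rewrite mem_iota ?add0n/=.
  by rewrite (leq_trans xt)// leq_pmul2l// leq_exp2r// ltnW.
by rewrite (leq_ltn_trans it).
Qed.

(** * Upper and lower bounds for the number of representations *)

Lemma p_leq (A M : set nat) (n : nat) (s : seq nat) :
  (forall a, A a -> (0 < a)%N) ->
  (forall m, (M `|` [set 0%N]) m -> (m <= n)%N -> m \in s) ->
  (p n A M <= size s ^ count_upto A n)%N.
Proof.
move=> A0 Ms; have fin := finite_representations n M A0.
set F : seq _ := fset_set (representations n A M).
have repF m : m \in F -> representations n A M m.
  by rewrite in_fset_set// => /set_mem.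
have s0 : (0 < size s)%N.
  by have : 0%N \in s by [apply: Ms => //; right]; case: s {Ms}.
have ms m a : m \in F -> m a \in s /\ (m a != 0%N -> (0 < a <= n)%N /\ A a).
  move=> /repF[mM mA nE].
  have [ma0|ma0] := eqVneq (m a) 0%N; first by rewrite ma0; split => //; apply: Ms => //; right.
  have Aa : A a by apply: contrapT => /mA /eqP; apply/negP.
  have : (m a * a <= n)%N.
    by rewrite nE (big_fsetD1 a)/= ?leq_addr// mem_finsupp.
  have := A0 a Aa => a0 man; split; last first.
    by move=> _; rewrite a0; split => //; nia.
  by apply: Ms; [exact: mM|nia].
set l := [seq a <- index_iota 1 n.+1 | `[< A a >]].
have -> : count_upto A n = size l by rewrite count_uptoE size_filter.
rewrite -[X in (X ^ _)%N]card_ord -[size l]card_ord -card_ffun.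
(* A representation is encoded by the positions in [s] of its coefficients on [l], outside which it
   vanishes. The default [Ordinal s0] is never reached on [F]. *)
pose f (m : {fsfun nat -> nat with 0%N}) : {ffun 'I_(size l) -> 'I_(size s)} :=
  [ffun i : 'I_(size l) => insubd (Ordinal s0) (index (m (nth 0%N l i)) s)].
have finj : {in F &, injective f}.
  move=> m m' mF m'F /ffunP ff; apply/fsfunP => a.
  have [al|al] := boolP (a \in l).
    have il : (index a l < size l)%N by rewrite index_mem.
    have := ff (Ordinal il); rewrite !ffunE/= nth_index//.
    move=> /(congr1 val); rewrite /= !val_insubd !index_mem.
    have [-> _] := ms m a mF; have [m's _] := ms m' a m'F; rewrite m's.
    move=> /(congr1 (nth 0%N s)); rewrite !nth_index//.
    by have [] := ms m a mF.
  have z k : k \in F -> k a = 0%N.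
    move=> kF; apply/eqP; apply: contraNT al => /(ms k a kF).2 [an Aa].
    by rewrite mem_filter mem_index_iota ltnS an andbT; apply/asboolP.
  by rewrite !z.
rewrite /p -/F -[size F](size_map f) cardE; apply: uniq_leq_size.
  by rewrite map_inj_in_uniq// /F fset_uniq.
by move=> y _; rewrite mem_enum.
Qed.

(** Positive coefficients make the support exactly the elements of [A] up to [N], so the sum over
    [finsupp] is the given one. *)
Lemma p_gt0 (A M : set nat) (N n : nat) (m : nat -> nat) :
  (forall a, A a -> (0 < a)%N) -> (forall a, M (m a) /\ (0 < m a)%N) ->
  n = (\sum_(1 <= a < N.+1 | `[< A a >]) m a * a)%N -> (0 < p n A M)%N.
Proof.
move=> A0 mM nE; rewrite cardfs_gt0; apply/fset0Pn.
set s := [seq a <- index_iota 1 N.+1 | `[< A a >]].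
have sA a : a \in s -> A a by rewrite mem_filter => /andP[/asboolP].
exists [fsfun a in [fset a in s]%fset => m a | 0%N].
rewrite in_fset_set; last exact: finite_representations.
apply/mem_set; split => [a Aa|a nA|].
- rewrite fsfun_fun; case: ifP => _; [left|right => //].
  exact: (mM a).1.
- rewrite fsfun_fun; case: ifP => //; rewrite in_fset /= => /sA //.
- set g := [fsfun a in _ => _ | _].
  have gs : finsupp g = [fset a in s]%fset.
    apply/fsetP => a; rewrite mem_finsupp fsfun_fun; case: ifP => // _.
    by rewrite -lt0n (mM a).2.
  rewrite gs nE -big_filter -/s.
  rewrite [RHS](perm_big s)/=; last first.
    rewrite uniq_perm ?fset_uniq ?filter_uniq ?iota_uniq// => a.
    exact: in_fset.
  by apply: eq_big_seq => a ains; rewrite fsfun_fun in_fset/= ains.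
Qed.

(** The hypothesis with [n ^ 3] is an integer form of [|A(n)| >= (3/4) log n / log t]; the lost
    quarter is recovered by working with powers of [t ^ 5]. *)
Lemma p_floats_gt0 (A : set nat) (n1 n : nat) :
  (forall a, A a -> (0 < a)%N) -> A 1%N ->
  (forall n t, (n1 <= n)%N -> (n <= 2 ^ t)%N ->
    (n ^ 3 <= t ^ (4 * count_upto A n))%N) ->
  (14 + 3 * n1 <= trunc_log 2 n)%N ->
  (0 < p n A floats)%N.
Proof.
move=> A0 A1 count_lb; set t := trunc_log 2 n => ht.
have n0 : (0 < n)%N by case: n @t ht.
have t14 : (14 <= t)%N by apply: leq_trans ht; rewrite leq_addr.
have t0 : (0 < t)%N by apply: leq_trans t14.
have n1t : (n1 <= t)%N by lia.
have nt : (n < 2 ^ t.+1)%N by apply: trunc_log_ltn.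
have tn : (2 ^ t <= n)%N by apply: trunc_logP.
(* Since [N ^ 3 <= 2 ^ t <= n], giving coefficient [N] to every element of [A] up to [N] costs at
   most [n]. *)
set u := (t %/ 3)%N; set N := (2 ^ u)%N.
have N1 : (n1 <= N)%N.
  by apply: leq_trans (ltnW (ltn_expl u (leqnn 2))); rewrite leq_divRL//; lia.
have Nt : (N <= 2 ^ t)%N by rewrite leq_exp2l// leq_div.
(* Compare fourth powers: [4 * (t + 1) <= 15 * u] holds for [t >= 14], and the density at [N],
   raised to the fifth power, bounds [2 ^ (15 * u)]. *)
have large : (2 ^ t.+1 <= (t ^ 5) ^ count_upto A N)%N.
  have h15 : (2 ^ (u * 3 * 5) <= t ^ (4 * count_upto A N * 5))%N.
    rewrite expnM [X in (_ <= X)%N]expnM leq_exp2r// expnM.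
    exact: count_lb.
  rewrite -(leq_exp2r _ _ (isT : 0 < 4)%N) -!expnM.
  have -> : (5 * (count_upto A N * 4) = 4 * count_upto A N * 5)%N by ring.
  by apply: leq_trans h15; rewrite leq_exp2l// /u; lia.
have small a : (a < N)%N -> A a.+1 -> (a.+1 <= (t ^ 5) ^ count_upto A a)%N.
  move=> aN Aa; case: a aN Aa => [_ _|a aN Aa]; first by rewrite expn_gt0 expn_gt0 t0.
  have c1 : (1 <= count_upto A a.+1)%N.
    apply: (@leq_trans (count_upto A 1)); last exact: leq_count_upto.
    by rewrite count_uptoS; case: asboolP => //; rewrite addn1.
  have [an1|an1] := leqP a.+2 n1.
    apply: (leq_trans an1); apply: (leq_trans n1t).
    by rewrite -expnM -{1}[t]expn1 leq_pexp2l// muln_gt0.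
  (* With [c] smaller elements, the density gives exponent [4 * (c + 1)], at most [15 * c] because
     [1] in [A] forces [c >= 1]. *)
  have := count_lb _ _ (ltnW an1) (leq_trans aN Nt).
  rewrite (count_uptoS A a.+1); case: asboolP => // _; rewrite addn1 => /= h3.
  rewrite -(leq_exp2r _ _ (isT : 0 < 3)%N); apply: (leq_trans h3).
  by rewrite -!expnM leq_pexp2l//; lia.
have sumN : (\sum_(1 <= a < N.+1 | `[< A a >]) N * a <= n)%N.
  apply: leq_trans tn; rewrite -big_distrr/=.
  have sN : (\sum_(1 <= a < N.+1 | `[< A a >]) a <= N * N)%N.
    have <- : (\sum_(1 <= a < N.+1) N = N * N)%N.
      by rewrite sum_nat_const_nat subSS subn0.
    rewrite big_mkcond/=.
    rewrite big_nat [X in (_ <= X)%N]big_nat; apply: leq_sum => i /andP[_ iN].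
    by case: asbool.
  apply: leq_trans (leq_mul (leqnn N) sN) _.
  rewrite /N -!expnD leq_exp2l// /u; lia.
have [||||f fP nE] := @greedy A (t ^ 5)%N t N
    (n - \sum_(1 <= a < N.+1 | `[< A a >]) N * a).
- by rewrite expn_gt0 t0.
- exact: small.
- exact: leq_ltn_trans (leq_subr _ _) (leq_trans nt large).
- exact: leq_ltn_trans (leq_subr _ _) nt.
apply: (@p_gt0 A floats N n (fun a => N + f a)%N) => //.
  move=> a; split; last by rewrite addn_gt0 expn_gt0.
  by have [x [i [xt it ->]]] := fP a; exists t, x, i.
rewrite -(subnKC sumN) nE -big_split/=.
by apply: eq_bigr => a _; rewrite mulnDl.
Qed.

(** * Logarithmic estimates from the density of [A] *)

Lemma log2_gt1 (R : realType) (n : nat) : (2 < n)%N -> 1 < log2 (n%:R : R).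
Proof.
move=> n2; rewrite /log2 ltr_pdivlMr ?ln_gt0 ?ltr1n// mul1r.
by rewrite ltr_ln ?posrE ?ltr_nat// ltr0n (ltn_trans _ n2).
Qed.

Lemma count_mul_ln (R : realType) (n : nat) (c e : R) : (2 < n)%N ->
  c = (1 + e) * (log2 (n%:R : R) / log2 (log2 (n%:R : R))) ->
  c * ln (log2 (n%:R : R)) = (1 + e) * ln n%:R.
Proof.
move=> n2 ->; have l1 := log2_gt1 R n2.
have ln2 : ln 2 != 0 :> R by rewrite gt_eqF// ln_gt0 ?ltr1n.
have lnl : ln (log2 (n%:R : R)) != 0 by rewrite gt_eqF// ln_gt0.
rewrite {1 2}/log2; set x := ln (log2 _) in lnl *; rewrite /log2.
by field; rewrite lnl ln2.
Qed.

Lemma log2_leq (R : realType) (n t : nat) : (0 < n)%N -> (n <= 2 ^ t)%N -> log2 (n%:R : R) <= t%:R.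
Proof.
move=> n0 nt; rewrite /log2 ler_pdivrMr ?ln_gt0 ?ltr1n//.
by rewrite mulr_natl -lnXn// ler_ln ?posrE ?exprn_gt0 ?ltr0n// -natrX ler_nat.
Qed.

Lemma trunc_log_le_log2 (R : realType) (n : nat) : (0 < n)%N -> (trunc_log 2 n)%:R <= log2 (n%:R : R).
Proof.
move=> n0; rewrite /log2 ler_pdivlMr ?ln_gt0 ?ltr1n//.
rewrite mulr_natl -lnXn// ler_ln ?posrE ?exprn_gt0 ?ltr0n// -natrX ler_nat.
exact: trunc_logP.
Qed.

(** As [log2 n <= t], one has [c * ln t >= (1 + e) * ln n >= (3/4) * ln n]. *)
Lemma count_lower (R : realType) (c n t : nat) (e : R) : (2 < n)%N -> - (4^-1) <= e ->
  c%:R = (1 + e) * (log2 (n%:R : R) / log2 (log2 (n%:R : R))) ->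
  (n <= 2 ^ t)%N -> (n ^ 3 <= t ^ (4 * c))%N.
Proof.
move=> n2 he /(count_mul_ln n2) cE nt.
have n0 : (0 < n)%N by apply: ltn_trans n2.
have l1 := log2_gt1 R n2; have lt := log2_leq R n0 nt.
have t1 : 1 < t%:R :> R by apply: lt_le_trans lt.
have t0 : 0 < t%:R :> R by apply: lt_trans t1.
have t0n : (0 < t)%N by move: t0; rewrite ltr0n.
rewrite -(ler_nat R) !natrX -ler_ln ?posrE ?exprn_gt0 ?ltr0n//.
  rewrite !lnXn ?ltr0n// -[_ *+ 3]mulr_natl -[_ *+ (4 * c)]mulr_natl natrM.
  have h1 : c%:R * ln (log2 (n%:R : R)) <= c%:R * ln t%:R.
    by rewrite ler_wpM2l// ler_ln ?posrE// (lt_trans _ l1).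
  have h2 : 0 <= ln (n%:R : R) by rewrite ln_ge0// ler1n.
  have := mulr_ge0 (_ : 0 <= e + 4^-1) h2; rewrite -(lerBlDr) sub0r => /(_ he).
  move: h1; rewrite cE; lra.
Qed.

(** The power [(log2 n) ^ (8 * c)] equals [exp (8 * (1 + e) * ln n)]. *)
Lemma pow_count_upper (R : realType) (c n : nat) (e : R) : (2 < n)%N ->
  c%:R = (1 + e) * (log2 (n%:R : R) / log2 (log2 (n%:R : R))) ->
  ((trunc_log 2 n ^ 8) ^ c)%:R <= (n%:R : R) `^ (8 + 8 * e).
Proof.
move=> n2 /(count_mul_ln n2) cE.
have n0 : (0 < n)%N by apply: ltn_trans n2.
have l0 := lt_trans ltr01 (log2_gt1 R n2).
rewrite -expnM natrX.
apply: (@le_trans _ _ (log2 (n%:R : R) ^+ (8 * c))).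
  by rewrite lerXn2r ?nnegrE ?(ltW l0)// trunc_log_le_log2.
rewrite -[log2 _ ^+ _]lnK ?posrE ?exprn_gt0// lnXn// -[_ *+ (8 * c)]mulr_natl natrM -mulrA cE.
by rewrite /powR pnatr_eq0 (gtn_eqF n0) mulrA mulrDr mulr1.
Qed.

(** * Choice of the thresholds and of the error term *)

Unset Implicit Arguments.

Theorem theorem1p2 (R : realType) (A : set nat)
    (A_pos : forall a, A a -> (0 < a)%N)
    (A_inf : infinite_set A)
    (A_one : A 1%N)
    (A_count : exists2 eps : nat -> R, eps n @[n --> \oo] --> (0 : R) &
      \forall n \near \oo,
        (count_upto A n)%:R =
          (1 + eps n) * (log2 (n%:R : R) / log2 (log2 (n%:R : R)))) :
  exists (n0 : nat) (M : set nat),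
    [/\ forall m, M m -> (0 < m)%N,
        infinite_set M
      & exists2 eps : nat -> R, eps n @[n --> \oo] --> (0 : R) &
          forall n : nat, (n0 < n)%N ->
            (0 < p n A M)%N /\
            (p n A M)%:R < (n%:R : R) `^ (8 + eps n)].
Proof.
have [eps eps0 [n1 _ hcount]] := A_count.
have [n2 _ heps] : \forall n \near \oo, `|eps n| <= 4^-1.
  by move/cvgr0_norm_le: eps0; apply.
(* From [n3] on, the density formula holds, [eps] is at most 1/4 in absolute value, and
   [log2 n > 1]. *)
set n3 := (3 + (n1 + n2))%N.
have count_lb n t : (n3 <= n)%N -> (n <= 2 ^ t)%N ->
    (n ^ 3 <= t ^ (4 * count_upto A n))%N.
  move=> n3n; apply: (@count_lower R _ _ _ (eps n)).
  - by rewrite /n3 in n3n; lia.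
  - by have := heps n; rewrite /= ler_norml => /(_ _)/andP[]//; rewrite /n3 in n3n; lia.
  - by apply: hcount; rewrite /= /n3 in n3n *; lia.
have [L0 hL0] := floats_leq.
pose t0 := (L0 + (14 + 3 * n3))%N.
exists (2 ^ t0 + n3)%N, floats; split.
- exact: floats_gt0.
- exact: infinite_floats.
(* The summand [1 / (n + 1)] makes the upper bound strict. *)
exists (fun n => 8 * eps n + n.+1%:R^-1).
  rewrite -[0 : R]addr0; apply: cvgD; last exact: cvg_harmonic.
  by rewrite -[0 : R](mulr0 8); apply: cvgMr.
move=> n hn.
have hn3 : (n3 < n)%N by apply: leq_ltn_trans hn; rewrite leq_addl.
have ht0 : (t0 <= trunc_log 2 n)%N.
  rewrite -(@trunc_expnK 2 t0)// leq_trunc_log// ltnW//.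
  by apply: leq_ltn_trans hn; rewrite leq_addr.
split.
  apply: (p_floats_gt0 A_pos A_one count_lb).
  by apply: leq_trans ht0; rewrite leq_addl.
have [|s [ss sP]] := hL0 n.
  by apply: leq_trans ht0; rewrite leq_addr.
have n2n : (2 < n)%N by rewrite /n3 in hn3; lia.
have hc : (count_upto A n)%:R = (1 + eps n) * (log2 (n%:R : R) / log2 (log2 (n%:R : R))).
  by apply: hcount; rewrite /= /n3 in hn3 *; lia.
apply: (@le_lt_trans _ _ (n%:R `^ (8 + 8 * eps n))).
  apply: le_trans (pow_count_upper n2n hc); rewrite ler_nat.
  apply: leq_trans (p_leq A_pos sP) _.
  by case: (count_upto A n) => // c; rewrite leq_exp2r.
have n0 : (0 < n)%N by apply: ltn_trans n2n.
rewrite /powR pnatr_eq0 (gtn_eqF n0) ltr_expR ltr_pM2r.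
  by rewrite addrA ltrDl invr_gt0.
by rewrite ln_gt0// ltr1n ltnW.
Qed.
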